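(* Let $p$ be a prime, let $q=p^f$ be a power of $p$, and let $E/F$ be a cyclic (Galois) extension of degree $n$ with $\mathrm{char}(F)=p$, $\mathrm{Gal}(E/F)=\langle\sigma\rangle$ and $\sigma(x)=x^q$ for all $x\in E$. If $y,z\in E$ satisfy $\mathrm{Tr}^E_F(y)=0$ and $\mathrm{Tr}^E_F(z)=1$, then $$x=\sum_{i=0}^{n-1}\sum_{j=0}^{i-1}z^{q^j}y^{q^i}$$ satisfies $x^q-x-y=0$.
   Context: A cyclic extension is a finite Galois extension with cyclic Galois group. The trace map is $\mathrm{Tr}^E_F(x)=\sum_{i=0}^{n-1}\sigma^i x$. Empty sums are $0$. *)

(* Defs.v *)
From HB Require Import structures.
From mathcomp Require Import all_boot all_order all_algebra all_fingroup all_solvable all_field.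

Set Implicit Arguments.
Unset Strict Implicit.
Unset Printing Implicit Defensive.

Import GRing.Theory.
Local Open Scope ring_scope.

(** The library trace [galTrace] sums over the Galois group as a set; for a
    generator [s] this is the trace written as a sum over the powers of [s]. *)
Lemma galTrace_cycle (F : fieldType) (E : splittingFieldType F) (n : nat)
    (s : gal_of {:E}) (a : E) :
  galois 1 {:E} -> \dim {:E} = n -> 'Gal({:E} / 1)%g = <[s]>%g ->
  galTrace 1 {:E} a = \sum_(i < n) (s ^+ i)%g a.
Proof.
move=> galE dimE genE.
have os : #[s]%g = n.
  by rewrite orderE -genE -(galois_dim galE) dimv1 divn1.
rewrite /galTrace (eq_bigl [in <[s]>%g]) => [|t]; last by rewrite -genE.
have img : {in <[s]>%g, forall t, exists i : 'I_n, t = (s ^+ i)%g}.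
  move=> t /cyclePmin [i]; rewrite os => lt_i ->.
  by exists (Ordinal lt_i).
have inj : injective (fun i : 'I_n => (s ^+ i)%g).
  move=> i j /eqP; rewrite eq_expg_mod_order os !modn_small ?ltn_ord // => /eqP.
  exact: val_inj.
rewrite (eq_bigl [in [set (s ^+ val i)%g | i in 'I_n]]) => [|t].
  by rewrite big_imset //= => i j _ _; apply: inj.
apply/idP/imsetP => [/img [i ->]|[i _ ->]]; first by exists i.
exact: mem_cycle.
Qed.

(* Main.v *)
Require Import Defs.
From HB Require Import structures.
From mathcomp Require Import all_boot all_order all_algebra all_fingroup all_solvable all_field.

Set Implicit Arguments.
Unset Strict Implicit.
Unset Printing Implicit Defensive.

Import GRing.Theory.
Local Open Scope ring_scope.

(* Additive Hilbert 90: with S_i = \sum_(j < i) s^j z, applying s to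
   x = \sum_i S_i s^i y turns S_i into S_(i+1) - z; the z part is killed by
   Tr y = 0, and the remaining sum minus x telescopes to S_n s^n y = y. *)
Lemma additive_hilbert90 (R : comNzRingType) (s : {rmorphism R -> R}) (n : nat)
    (y z : R) (x := \sum_(i < n) \sum_(j < i) iter j s z * iter i s y) :
  iter n s y = y -> \sum_(i < n) iter i s y = 0 ->
  \sum_(i < n) iter i s z = 1 -> s x = x + y.
Proof.
move=> yn y_tr0 z_tr1; pose S i := \sum_(j < i) iter j s z.
have sS i : s (S i) = S i.+1 - z.
  (* The term [j = 0] of [S i.+1] is [z]; the terms with [j > 0] are the images under [s] of those
     of [S i]. *)
  by rewrite /S big_ord_recl /= addrC addKr raddf_sum.
have xE : x = \sum_(i < n) S i * iter i s y.
  by apply: eq_bigr => i _; rewrite mulr_suml.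
have -> : s x = \sum_(i < n) S i.+1 * iter i.+1 s y.
  have str : \sum_(i < n) iter i.+1 s y = 0.
    by have := congr1 s y_tr0; rewrite raddf_sum raddf0.
  have zstr : \sum_(i < n) z * iter i.+1 s y = 0 by rewrite -mulr_sumr str mulr0.
  (* Subtracting 0, written as [z] times the shifted trace of [y], makes both sides agree term by
     term. *)
  rewrite xE rmorph_sum -[RHS]subr0 -[X in _ = _ - X]zstr -sumrB.
  by apply: eq_bigr => i _; rewrite rmorphM /= sS mulrBl.
apply/eqP; rewrite addrC -subr_eq; apply/eqP.
rewrite xE -sumrB.
rewrite -(big_mkord xpredT
  (fun i => S i.+1 * iter i.+1 s y - S i * iter i s y)).
rewrite (telescope_sumr (fun i => S i * iter i s y)) //.
(* At the upper end [S n] is the trace of [z], that is 1; at the lower end [S 0] is an empty sum. *)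
by rewrite yn {1}/S z_tr1 mul1r /S big_ord0 mul0r subr0.
Qed.

Theorem corollary4p1 (p f q n : nat) (F : fieldType) (E : splittingFieldType F)
    (sigma : gal_of {:E}) (y z : E)
    (p_prime : prime p)
    (q_def : q = (p ^ f)%N)
    (galE : galois 1 {:E})
    (dimE : \dim {:E} = n)
    (charF : p \in [pchar F])
    (gen_sigma : 'Gal({:E} / 1)%g = <[sigma]>%g)
    (sigma_def : forall x : E, sigma x = x ^+ q)
    (tr_y : galTrace 1 {:E} y = 0)
    (tr_z : galTrace 1 {:E} z = 1) :
  let x := \sum_(i < n) \sum_(j < i) z ^+ (q ^ j) * y ^+ (q ^ i) in
  x ^+ q - x - y = 0.
Proof.
have iterE i a : iter i sigma a = a ^+ (q ^ i).
  elim: i => [|i IHi]; first by rewrite expr1.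
  by rewrite iterS IHi sigma_def -exprM expnSr.
have galXE i a : (sigma ^+ i)%g a = iter i sigma a.
  elim: i => [|i IHi]; first by rewrite expg0 gal_id.
  by rewrite expgSr galM ?memvf // IHi.
have trE a : galTrace 1 {:E} a = \sum_(i < n) iter i sigma a.
  by rewrite (galTrace_cycle a galE dimE gen_sigma); apply: eq_bigr => i _.
have yn : iter n sigma y = y.
  (* The generator [sigma] has the order of the Galois group, which is the degree of the
     extension. *)
  have <- : #[sigma]%g = n.
    by rewrite orderE -gen_sigma -(galois_dim galE) dimv1 divn1.
  by rewrite -galXE expg_order gal_id.
rewrite trE in tr_y; rewrite trE in tr_z.
move=> x.
have xE : x = \sum_(i < n) \sum_(j < i) iter j sigma z * iter i sigma y.
  by apply: eq_bigr => i _; apply: eq_bigr => j _; rewrite !iterE.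
(* Reading the [q]-th power as [sigma] turns the goal into [sigma x = x + y]. *)
rewrite -sigma_def; apply/eqP; rewrite -addrA -opprD subr_eq0; apply/eqP.
by rewrite xE; apply: additive_hilbert90.
Qed.
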